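(* Let $G=(V,E)$ be an arbitrary graph with maximum degree $\Delta$. One can construct in polynomial time a triangle-free graph $\widehat G$ such that $\mathrm{rel\text{-}IS}(\widehat G)=\mathrm{rel\text{-}IS}(G)$.
   Context: For a graph $G=(V,E)$, $\mathrm{IS}(G)$ is the size of a maximum independent set and $\mathrm{rel\text{-}IS}(G)=\mathrm{IS}(G)/|V|$. A graph is triangle-free if it contains no cycle of length 3. *)

(* Defs.v *)
From mathcomp Require Import all_boot all_order all_algebra.

Set Implicit Arguments.
Unset Strict Implicit.
Unset Printing Implicit Defensive.

Import GRing.Theory.

Record graph := Graph {
  vertex :> finType;
  adj : rel vertex;
  adj_sym : symmetric adj;
  adj_irr : irreflexive adj }.

Definition max_degree (G : graph) : nat :=
  \max_(v : G) #|[set u : G | adj v u]|.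

Definition independent (G : graph) (S : {set G}) : bool :=
  [forall u in S, forall v in S, ~~ adj u v].

Definition IS (G : graph) : nat :=
  \max_(S : {set G} | independent S) #|S|.

(* For the graph without vertices this is 0 / 0, which is 0 in rat. *)
Definition rel_IS (G : graph) : rat := ((IS G)%:R / #|G|%:R)%R.

Definition triangle_free (G : graph) : Prop :=
  ~ exists s : seq G, ucycle (@adj G) s /\ size s = 3.

(* The random access machine of Cook and Reckhow: registers X_0, X_1, ...     *)
(* hold natural numbers and are initially 0, the input is read from, and the  *)
(* output printed to, one-way tapes.  There is no multiplication, so that     *)
(* the numbers gain at most one bit per step, and a polynomial number of      *)
(* steps is polynomial time in the Turing machine sense.                      *)
Variant instr :=
  | IConst of nat & nat         (* X_i <- c            *)
  | IAdd of nat & nat & nat     (* X_i <- X_j + X_k    *)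
  | ISub of nat & nat & nat     (* X_i <- X_j - X_k, truncated at 0 *)
  | ILoad of nat & nat          (* X_i <- X_(X_j)      *)
  | IStore of nat & nat         (* X_(X_i) <- X_j      *)
  | IJumpPos of nat & nat       (* go to line m if X_j > 0 *)
  | IRead of nat                (* X_i <- next input, 0 if there is none *)
  | IPrint of nat.

Definition program := seq instr.

Record config := Config {
  pc : nat;
  reg : nat -> nat;
  inp : seq nat;
  out : seq nat }.

Definition set_reg (c : config) (i x : nat) : config :=
  Config (pc c).+1 [eta reg c with i |-> x] (inp c) (out c).

Definition exec (a : instr) (c : config) : config :=
  let X := reg c in
  match a with
  | IConst i n => set_reg c i n
  | IAdd i j k => set_reg c i (X j + X k)
  | ISub i j k => set_reg c i (X j - X k)
  | ILoad i j => set_reg c i (X (X j))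
  | IStore i j => set_reg c (X i) (X j)
  | IJumpPos m j => Config (if 0 < X j then m else (pc c).+1) X (inp c) (out c)
  | IRead i => Config (pc c).+1 [eta X with i |-> head 0 (inp c)]
                (behead (inp c)) (out c)
  | IPrint i => Config (pc c).+1 X (inp c) (rcons (out c) (X i))
  end.

(* A machine whose program counter has left the program has halted. *)
Definition step (P : program) (c : config) : config :=
  if onth P (pc c) is Some a then exec a c else c.

Definition init_config (x : seq nat) : config := Config 0 (fun=> 0) x [::].

Definition halts_within (P : program) (x : seq nat) (t : nat) (y : seq nat) :=
  let c := iter t (step P) (init_config x) in size P <= pc c /\ out c = y.

(* The number of vertices, then the adjacency matrix in row-major order. *)
Definition encode (G : graph) : seq nat :=
  #|G| :: [seq nat_of_bool (adj u v) | u <- enum G, v <- enum G].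

(* The encoding of G has length #|G| ^ 2 + 1, so that being polynomial in     *)
(* #|G| is being polynomial in the size of the input.                         *)
Definition polytime (f : graph -> graph) : Prop :=
  exists (P : program) (p : {poly nat}), forall G : graph,
    halts_within P (encode G) (p.[#|G|])%R (encode (f G)).

(* Main.v *)
Require Import Defs.
From mathcomp Require Import all_boot all_order all_algebra.
From mathcomp Require Import zify ring.

(** Let n be the number of vertices of G, p a prime with p >= n^2 + 4n + 8, and
order V(G).  Blow every vertex up to a copy of F_p^2 and, for each edge uv with
u < v, join (u, x) to (v, y) when y - x = (t, t^2) with t <> 0.  A triangle would
give (s, s^2) + (t, t^2) = (r, r^2), hence 2 s t = 0.

Two points of F_p^2 have at most one common neighbour, so by Cauchy-Schwarz a set
of size a has at least q^2 a / (q + a) neighbours, where q = p - 1.  Let w u be the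
size of the trace of an independent set on the copy over u, and call u small if
n (q + w u) <= q^2.  The vertices that are not small are pairwise nonadjacent.  A
small u with such a neighbour v satisfies n (w u) <= p^2 - w v, so all of them
together only fill up the room left over these v; the remaining small vertices
together weigh at most p^2, and any one of them can be added to the independent set
of the vertices that are not small.  Hence an independent set has at most
IS(G) p^2 elements.

The prime is found by trial division; the central binomial coefficient shows that
one occurs below a polynomial bound. *)

Set Implicit Arguments.
Unset Strict Implicit.
Unset Printing Implicit Defensive.

Import GRing.Theory.

(** * Primes in a polynomial range *)

(** By Legendre's formula the exponent of p is the sum over k of m.*2 %/ p ^ k - 2 (m %/ p ^ k).
    Each term is at most 1 and vanishes once p ^ k exceeds m.*2, so the exponent is at most the
    integer logarithm of m.*2 to base p. *)
Lemma logn_central_bin p m : prime p -> 0 < m ->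
  p ^ logn p 'C(m.*2, m) <= m.*2.
Proof.
move=> p_pr m_gt0; have p_gt1 := prime_gt1 p_pr.
have m2_gt0 : 0 < m.*2 by rewrite double_gt0.
have lem : m <= m.*2 by rewrite -addnn leq_addr.
have defm : m.*2 - m = m by rewrite -addnn addnK.
have := congr1 (logn p) (bin_fact lem); rewrite defm.
rewrite !lognM ?muln_gt0 ?fact_gt0 ?bin_gt0 // !logn_fact // => def_log.
apply: leq_trans (trunc_logP p_gt1 m2_gt0); rewrite leq_exp2l //.
set T := trunc_log p m.*2.
have big0 k : T < k -> m.*2 %/ p ^ k = 0.
  move=> ltTk; apply: divn_small; apply: leq_trans (trunc_log_ltn _ p_gt1) _.
  by rewrite leq_exp2l.
have leT : T <= m.*2.
  by apply: leq_trans (trunc_logP p_gt1 m2_gt0); rewrite ltnW // ltn_expl.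
(* Legendre's sum for m! stops at m; the terms added up to m.*2 are zero, and both sums now have the
   same range. *)
have sum_m : \sum_(1 <= k < m.+1) m %/ p ^ k = \sum_(1 <= k < m.*2.+1) m %/ p ^ k.
  rewrite [RHS](big_cat_nat _ (n := m.+1)) //= [X in _ + X]big_nat_cond.
  rewrite [X in _ + X]big1 ?addn0 // => k /andP[/andP[lt_mk _] _].
  by apply: divn_small; apply: ltn_trans lt_mk _; rewrite ltn_expl.
rewrite sum_m -big_split /= in def_log.
suff : \sum_(1 <= k < m.*2.+1) m.*2 %/ p ^ k <=
       T + \sum_(1 <= k < m.*2.+1) (m %/ p ^ k + m %/ p ^ k).
  by rewrite -def_log leq_add2r.
(* T becomes a sum of indicators, so that the comparison can be made term by term. *)
have -> : T = \sum_(1 <= k < m.*2.+1) (k <= T).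
  rewrite (big_cat_nat _ (n := T.+1)) //= [X in _ + X]big_nat_cond.
  rewrite [X in _ + X]big1 ?addn0; last first.
    by move=> k /andP[/andP[ltTk _] _]; rewrite leqNgt ltTk.
  rewrite big_nat_cond (eq_bigr (fun=> 1)); last first.
    by move=> k /andP[/andP[_ ltkT] _]; rewrite -ltnS ltkT.
  by rewrite -big_nat_cond sum_nat_const_nat subn1 muln1.
rewrite -big_split /=; apply: leq_sum => k _.
case: (leqP k T) => [_ | ltTk]; last by rewrite big0.
by rewrite addnC -{1}addnn leq_divDl.
Qed.

(** By symmetry the two Pascal summands of C(2m+2, m+1) are equal, and each is at least C(2m, m), so
    every step at least doubles the value. *)
Lemma central_bin_ge m : 2 ^ m <= 'C(m.*2, m).
Proof.
elim: m => // m IHm.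
have symC : 'C(m.*2.+1, m.+1) = 'C(m.*2.+1, m).
  by rewrite -[LHS]bin_sub; [congr 'C(_, _); lia | lia].
rewrite doubleS expnS binS symC addnn -mul2n leq_mul2l /= -symC binS.
by rewrite (leq_trans IHm) ?leq_addl.
Qed.

Lemma sqrn_lt_exp2 M : 8 <= M -> 2 * M ^ 2 < 2 ^ M.
Proof.
elim: M => // M IH; rewrite leq_eqVlt => /predU1P[<- // | lt8M].
by have := IH lt8M; rewrite [2 ^ M.+1]expnS -!mulnn; nia.
Qed.

(* If all primes up to 2 M^2 were smaller than M, then C(2 M^2, M^2), in which
   every prime power is at most 2 M^2, would be at most (2 M^2)^M < 2^(M^2). *)
Lemma prime_between M : 8 <= M -> exists p, [&& prime p, M <= p & p <= 2 * M ^ 2].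
Proof.
move=> M_ge8; pose m := M ^ 2.
have [/existsP[p ] | none] :=
  boolP [exists p : 'I_(2 * M ^ 2).+1, prime p && (M <= p)].
  by case/andP=> p_pr leMp; exists p; rewrite p_pr leMp -ltnS /=.
have m_gt0 : 0 < m by rewrite expn_gt0; lia.
have C_gt0 : 0 < 'C(m.*2, m) by rewrite bin_gt0; lia.
suff : 'C(m.*2, m) <= (2 * M ^ 2) ^ M.
  move=> leC; have := leq_trans (central_bin_ge m) leC.
  have M_gt0 : 0 < M by lia.
  by rewrite {1}/m -{1}mulnn expnM leq_exp2r // leqNgt sqrn_lt_exp2.
(* The binomial coefficient is the product of its prime parts. The maximum makes the range of the
   product reach M, where it is split. *)
rewrite -{1}(partnT C_gt0) (@widen_partn (maxn 'C(m.*2, m) (2 * M ^ 2))) ?leq_maxl //.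
have -> : (2 * M ^ 2) ^ M = \prod_(0 <= i < M) m.*2.
  by rewrite prod_nat_const_nat subn0 -mul2n.
set K := maxn _ _.
have leMK : M <= K.+1 by rewrite /K; nia.
(* Factors from M on are 1: a prime dividing the coefficient is at most 2 M^2, and [none] excludes
   such primes from M on. *)
rewrite (big_cat_nat _ (n := M)) //= [X in _ * X]big_nat_cond.
rewrite [X in _ * X]big1 ?muln1; last first.
  move=> p /andP[/andP[leMp _] _].
  have [p_pr | /negPf Np] := boolP (prime p); last by rewrite lognE Np.
  have := logn_central_bin p_pr m_gt0.
  case: (posnP (logn p 'C(m.*2, m))) => [-> // | l_gt0 lep].
  case/negP: none; apply/existsP.
  have lt_p : p < (2 * M ^ 2).+1.
    rewrite ltnS mul2n; apply: leq_trans lep.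
    by rewrite -{1}[p]expn1 leq_exp2l // prime_gt1.
  by exists (Ordinal lt_p); rewrite /= p_pr.
apply: leq_prod => p _.
have [p_pr | /negPf Np] := boolP (prime p); first exact: logn_central_bin.
by rewrite lognE Np /= double_gt0.
Qed.

Lemma next_prime_subproof m : exists p, prime p && (m <= p).
Proof. by have [p lt_mp p_pr] := prime_above m; exists p; rewrite p_pr ltnW. Qed.

(** Minimality makes this the number at which an upward search by trial division stops. *)
Definition next_prime (m : nat) : nat := ex_minn (next_prime_subproof m).

Lemma next_primeP m : [/\ prime (next_prime m), m <= next_prime m &
  forall q, prime q -> m <= q -> next_prime m <= q].
Proof.
rewrite /next_prime; case: ex_minnP => p /andP[p_pr le_mp] minp; split=> // q q_pr le_mq.
by apply: minp; rewrite q_pr.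
Qed.

Lemma next_prime_le M : 8 <= M -> next_prime M <= 2 * M ^ 2.
Proof.
case/prime_between=> p /and3P[p_pr le_Mp le_p].
by have [_ _ /(_ p p_pr le_Mp) /leq_trans-> //] := next_primeP M.
Qed.

(** * Expansion of the parabola *)

(** After doubling, both sides are double sums over B, compared termwise by 2ab <= a^2 + b^2. *)
Lemma sum_Cauchy (T : finType) (B : {set T}) (d : T -> nat) :
  (\sum_(y in B) d y) ^ 2 <= #|B| * \sum_(y in B) d y ^ 2.
Proof.
rewrite -(leq_pmul2l (isT : 0 < 2)) -mulnn big_distrlr /= [leqRHS]mulnCA.
have -> : #|B| * (2 * \sum_(y in B) d y ^ 2) =
    \sum_(y in B) \sum_(z in B) (d y ^ 2 + d z ^ 2).
  under [RHS]eq_bigr do rewrite big_split sum_nat_const.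
  by rewrite big_split -big_distrr sum_nat_const /= -mulnDr addnn -mul2n.
rewrite big_distrr; apply: leq_sum => y _.
by rewrite big_distrr; apply: leq_sum => z _ /=; rewrite nat_Cauchy.
Qed.

(** Let d y count the x in A related to y. Then d sums to q |A|, while the sum of d^2 counts common
    neighbours of ordered pairs in A and is at most |A| (q + |A|). Cauchy-Schwarz over the
    neighbourhood, divided by |A|, gives the bound. *)
Lemma card_image_rel (T : finType) (R : rel T) q (A : {set T}) :
    (forall x, #|[set y | R x y]| = q) ->
    (forall x x', x != x' -> #|[set y | R x y && R x' y]| <= 1) ->
  q ^ 2 * #|A| <= #|[set y | [exists x in A, R x y]]| * (q + #|A|).
Proof.
move=> degR codegR; set N := [set y | _].
have [-> | A_neq0] := eqVneq A set0; first by rewrite cards0 muln0.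
pose d y := \sum_(x in A) R x y : nat.
have d0 y : y \notin N -> d y = 0.
  rewrite inE => /existsPn noR; apply: big1 => x xA.
  by have := noR x; rewrite xA /= => /negPf->.
have sumN (h : nat -> nat) : h 0 = 0 -> \sum_(y in N) h (d y) = \sum_y h (d y).
  move=> h0; rewrite [RHS](bigID (mem N)) /= [X in _ = _ + X]big1 ?addn0 //.
  by move=> y /d0->.
have sum_d : \sum_(y in N) d y = #|A| * q.
  rewrite (sumN id) // exchange_big /= -sum_nat_const.
  apply: eq_bigr => x _; rewrite -(degR x) -sum1dep_card [RHS]big_mkcond.
  by apply: eq_bigr => y _; case: (R x y).
have sum_d2 : \sum_(y in N) d y ^ 2 <= #|A| * (q + #|A|).
  rewrite (sumN (expn^~ 2)) //.
  have -> : \sum_y d y ^ 2 =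
      \sum_(x in A) \sum_(x' in A) #|[set y | R x y && R x' y]|.
    rewrite (eq_bigr (fun y => \sum_(x in A) \sum_(x' in A) R x y * R x' y)).
      rewrite exchange_big; apply: eq_bigr => x _.
      rewrite exchange_big; apply: eq_bigr => x' _ /=.
      rewrite -sum1dep_card [RHS]big_mkcond.
      by apply: eq_bigr => y _; rewrite mulnb; case: (_ && _).
    by move=> y _; rewrite -mulnn /d big_distrlr.
  rewrite -sum_nat_const; apply: leq_sum => x xA.
  (* The diagonal pair contributes the degree q, every other pair at most 1. *)
  rewrite (bigD1 x) //=; apply: leq_add.
    by rewrite -(degR x); apply/subset_leq_card/subsetP => y; rewrite !inE => /andP[].
  rewrite -sum1_card big_mkcondr /=; apply: leq_sum => x' _.
  by case: eqVneq => //= neq; rewrite codegR // eq_sym.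
have := sum_Cauchy N d; rewrite sum_d => cauchy.
have A_gt0 : 0 < #|A| by rewrite card_gt0.
rewrite -(leq_pmul2l A_gt0).
apply: leq_trans (_ : #|N| * (#|A| * (q + #|A|)) <= _); last by rewrite mulnCA.
apply: leq_trans (leq_mul (leqnn _) sum_d2); apply: leq_trans cauchy.
by rewrite expnMn -mulnn mulnA mulnC mulnA.
Qed.

(** One of the truncated differences is 0, so this is |a - b|^2, in the form in which the machine
    can compute it. *)
Definition distn_sq (a b : nat) : nat := (a - b + (b - a)) ^ 2.

(** The difference y - x is a point (t, t^2) with t nonzero. Ordinals and natural numbers modulo p
    match what the machine handles; [parabolaE] restates the relation in the field. *)
Definition parabola (p : nat) (x y : 'I_p * 'I_p) : bool :=
  (x.1 != y.1) && (y.2 == (x.2 + distn_sq x.1 y.1) %% p :> nat).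

Section Parabola.

Variables (p : nat).
Hypothesis p_pr : prime p.

Local Notation fp x := ((nat_of_ord (x : 'I_p))%:R : 'F_p)%R.

Lemma natr_Fp_eq (a b : nat) : (a%:R == b%:R :> 'F_p)%R = (a == b %[mod p]).
Proof. by rewrite -val_eqE /= !val_Fp_nat. Qed.

Lemma ord_Fp_inj (x y : 'I_p) : fp x = fp y -> x = y.
Proof. by move/eqP; rewrite natr_Fp_eq !modn_small // => /eqP/val_inj. Qed.

Definition ord_of_Fp (e : 'F_p) : 'I_p := cast_ord (Fp_cast p_pr) e.

Lemma ord_of_FpK e : fp (ord_of_Fp e) = e.
Proof. by rewrite /= natr_Zp. Qed.

Lemma distn_sq_Fp a b : ((distn_sq a b)%:R = (b%:R - a%:R) ^+ 2 :> 'F_p)%R.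
Proof.
rewrite /distn_sq natrX natrD; case: (leqP a b) => [le_ab | /ltnW le_ba].
  by move/eqP: (le_ab) => ->; rewrite add0r natrB.
by move/eqP: (le_ba) => ->; rewrite addr0 natrB // -sqrrN opprB.
Qed.

Lemma parabolaE (x y : 'I_p * 'I_p) :
  parabola x y = (x.1 != y.1) && (fp y.2 == fp x.2 + (fp y.1 - fp x.1) ^+ 2)%R.
Proof.
rewrite /parabola -distn_sq_Fp -natrD natr_Fp_eq [in RHS]modn_small //.
Qed.

(** Out- and in-neighbourhoods of a point both have this shape: the first coordinate takes all
    values but one and determines the second. *)
Lemma card_fun_graph (a : 'I_p) (h : 'I_p -> 'I_p) :
  #|[set y : 'I_p * 'I_p | (a != y.1) && (y.2 == h y.1)]| = p.-1.
Proof.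
rewrite -[in RHS](card_ord p) -(cardsC1 a).
have inj : injective (fun b => (b, h b)) by move=> b b' [].
rewrite -(card_imset _ inj); apply: eq_card => -[b c]; rewrite !inE /=.
apply/andP/imsetP => [[neq /eqP->] | [b' ]]; first by exists b; rewrite // !inE eq_sym.
by rewrite !inE => neq [-> ->]; rewrite eq_sym.
Qed.

Lemma parabola_out (x : 'I_p * 'I_p) : #|[set y | parabola x y]| = p.-1.
Proof.
rewrite -(card_fun_graph x.1
  (fun b => ord_of_Fp (fp x.2 + (fp b - fp x.1) ^+ 2)%R)).
apply: eq_card => y; rewrite !inE parabolaE; congr (_ && _).
by apply/eqP/eqP => [<- | ->]; [apply: ord_Fp_inj|]; rewrite ord_of_FpK.
Qed.

Lemma parabola_in (x : 'I_p * 'I_p) : #|[set y | parabola y x]| = p.-1.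
Proof.
rewrite -(card_fun_graph x.1
  (fun b => ord_of_Fp (fp x.2 - (fp x.1 - fp b) ^+ 2)%R)).
apply: eq_card => y; rewrite !inE parabolaE eq_sym; congr (_ && _).
apply/eqP/eqP => [E | ->]; last by rewrite ord_of_FpK subrK.
by apply: ord_Fp_inj; rewrite ord_of_FpK E addrK.
Qed.

Hypothesis p_gt2 : 2 < p.

Lemma two_Fp_neq0 : (2%:R != 0 :> 'F_p)%R.
Proof. by rewrite -(mulr0n 1) natr_Fp_eq mod0n modn_small. Qed.

(** Subtracting the two equations for a common neighbour y leaves an equation that is linear in y.1
    with slope 2 (x.1 - x'.1). It has one solution when the first coordinates differ; when they
    agree, it forces x = x'. *)
Lemma parabola_common_out (x x' : 'I_p * 'I_p) : x != x' ->
  #|[set y | parabola x y && parabola x' y]| <= 1.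
Proof.
move=> neq; apply/card_le1_eqP => y z; rewrite !inE !parabolaE.
move=> /andP[/andP[_ /eqP y1] /andP[_ /eqP y2]] /andP[/andP[_ /eqP z1] /andP[_ /eqP z2]].
have [eq1 | neq1] := eqVneq x.1 x'.1.
  case/negP: neq; rewrite -pair_eqE /= eq1 eqxx; apply/eqP/ord_Fp_inj.
  by apply: (addIr ((fp y.1 - fp x.1) ^+ 2)%R); rewrite -y1 y2 eq1.
have eqyz : y.1 = z.1.
  apply/ord_Fp_inj/eqP; rewrite -subr_eq0.
  have : ((2%:R * (fp x.1 - fp x'.1)) * (fp y.1 - fp z.1) == 0)%R.
    (* The same difference of second coordinates is computed once through y and once through z. *)
    apply/eqP; transitivity ((fp x.2 - fp x'.2) - (fp x.2 - fp x'.2) : 'F_p)%R.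
      have e1 : (fp x.2 - fp x'.2 = (fp y.1 - fp x'.1) ^+ 2 - (fp y.1 - fp x.1) ^+ 2)%R.
        transitivity (fp x.2 + (fp y.1 - fp x.1) ^+ 2 - (fp y.1 - fp x.1) ^+ 2 - fp x'.2)%R.
          by ring.
        by rewrite -y1 y2; ring.
      have e2 : (fp x.2 - fp x'.2 = (fp z.1 - fp x'.1) ^+ 2 - (fp z.1 - fp x.1) ^+ 2)%R.
        transitivity (fp x.2 + (fp z.1 - fp x.1) ^+ 2 - (fp z.1 - fp x.1) ^+ 2 - fp x'.2)%R.
          by ring.
        by rewrite -z1 z2; ring.
      by rewrite {1}e1 e2; ring.
    by rewrite subrr.
  rewrite !mulf_eq0 (negPf two_Fp_neq0) !subr_eq0 /= => /orP[/eqP E|//].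
  by rewrite (ord_Fp_inj E) eqxx in neq1.
apply/eqP; rewrite -pair_eqE /= eqyz eqxx; apply/eqP/ord_Fp_inj.
by rewrite y1 z1 eqyz.
Qed.

(** Two common in-neighbours y, z of x and x' would make x and x' two common out-neighbours of y and
    z. *)
Lemma parabola_common_in (x x' : 'I_p * 'I_p) : x != x' ->
  #|[set y | parabola y x && parabola y x']| <= 1.
Proof.
move=> neq; rewrite leqNgt; apply/negP => /card_gt1P[y [z [yP zP neqyz]]].
have := parabola_common_out neqyz; rewrite leqNgt => /negP; apply.
apply/card_gt1P; exists x, x'; move: yP zP; rewrite !inE.
by move=> /andP[-> ->] /andP[-> ->].
Qed.

Lemma parabola_no_triangle (x y z : 'I_p * 'I_p) :
  parabola x y -> parabola y z -> parabola x z -> False.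
Proof.
rewrite !parabolaE => /andP[xy /eqP e1] /andP[yz /eqP e2] /andP[_ /eqP e3].
have : (2%:R * (fp y.1 - fp x.1) * (fp z.1 - fp y.1) == 0)%R.
  apply/eqP; transitivity (fp z.2 - fp z.2 : 'F_p)%R; last by rewrite subrr.
  by rewrite {1}e3 e2 e1; ring.
rewrite !mulf_eq0 (negPf two_Fp_neq0) !subr_eq0 /=.
case/orP=> /eqP E; first by rewrite (ord_Fp_inj E) eqxx in xy.
by rewrite (ord_Fp_inj E) eqxx in yz.
Qed.

(** Here A and B play the traces of an independent set over the two ends of an edge: the
    neighbourhood of A avoids B, hence has at most p^2 - |B| points. *)
Definition expanding (R : rel ('I_p * 'I_p)) := forall A B : {set 'I_p * 'I_p},
  {in A & B, forall x y, ~~ R x y} ->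
  p.-1 ^ 2 * #|A| <= (p ^ 2 - #|B|) * (p.-1 + #|A|).

Lemma expanding_rel (R : rel ('I_p * 'I_p)) :
    (forall x, #|[set y | R x y]| = p.-1) ->
    (forall x x', x != x' -> #|[set y | R x y && R x' y]| <= 1) ->
  expanding R.
Proof.
move=> degR codegR A B noR; apply: leq_trans (card_image_rel A degR codegR) _.
rewrite leq_mul2r; apply/orP; right.
have -> : p ^ 2 - #|B| = #|~: B| 
  by have := cardsC B; rewrite card_prod card_ord mulnn => <-; rewrite addKn.
apply/subset_leq_card/subsetP => y; rewrite !inE => /existsP[x /andP[xA Rxy]].
by apply: contraL Rxy => yB; apply: noR.
Qed.

Lemma expanding_parabola : expanding (@parabola p).
Proof. exact: expanding_rel parabola_out parabola_common_out. Qed.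

Lemma expanding_parabolaC : expanding (fun x y => parabola y x).
Proof. exact: expanding_rel parabola_in parabola_common_in. Qed.

End Parabola.

(** * The lifted graph *)

(** The weight argument requires n^2 + 4n <= p - 1. The 8 brings the bound into the range of
    [next_prime_le] even for n = 0, and makes the prime odd. *)
Definition side_bound (n : nat) : nat := n * n + 4 * n + 8.

Definition side (n : nat) : nat := next_prime (side_bound n).

Lemma side_prime n : prime (side n).
Proof. by have [] := next_primeP (side_bound n). Qed.

Lemma side_ge n : side_bound n <= side n.
Proof. by have [] := next_primeP (side_bound n). Qed.

Lemma side_gt2 n : 2 < side n.
Proof. by apply: leq_trans (side_ge n); rewrite /side_bound; lia. Qed.

(** As [parabola] is not symmetric, each edge of G is directed from the end of smaller rank to the
    end of larger rank. *)
Definition lift_rel (G : graph) : rel (G * ('I_(side #|G|) * 'I_(side #|G|))) :=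
  fun a b => adj a.1 b.1 &&
    if enum_rank a.1 < enum_rank b.1 then parabola a.2 b.2 else parabola b.2 a.2.

Lemma lift_rel_sym G : symmetric (@lift_rel G).
Proof.
move=> a b; rewrite /lift_rel adj_sym.
case: (boolP (adj b.1 a.1)) => //= ab.
case: ltngtP => // /val_inj/enum_rank_inj E.
by rewrite E adj_irr in ab.
Qed.

Lemma lift_rel_irr G : irreflexive (@lift_rel G).
Proof. by move=> a; rewrite /lift_rel adj_irr. Qed.

Definition lift_graph (G : graph) : graph :=
  Graph (@lift_rel_sym G) (@lift_rel_irr G).

(** A triangle projects to three pairwise adjacent vertices of G. Directing edges by rank leaves no
    directed cycle, so it is a transitive triple, which [parabola_no_triangle] excludes. *)
Lemma lift_triangle_free G : triangle_free (lift_graph G).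
Proof.
case=> s [/andP[+ _] sz3].
case: s sz3 => [//|a [//|b [//|c [|//]]]] _ /= /and4P[+ + + _].
rewrite /lift_rel => /andP[adj_ab Hab] /andP[_ Hbc] /andP[_ Hca].
have noT := @parabola_no_triangle _ (side_prime #|G|) (side_gt2 #|G|).
have neq_ab : enum_rank a.1 != enum_rank b.1.
  by rewrite (inj_eq enum_rank_inj); apply: contraTneq adj_ab => ->; rewrite adj_irr.
(* Of the eight orientations, the first and the last are cyclic and contradict the order of the
   ranks; the other six are transitive triples. *)
move: Hab Hbc Hca; case: (ltnP (enum_rank a.1)) => ab;
  case: (ltnP (enum_rank b.1)) => bc; case: (ltnP (enum_rank c.1)) => ca Hab Hbc Hca.
- by have := ltn_trans ab (ltn_trans bc ca); rewrite ltnn.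
- exact: noT Hab Hbc Hca.
- exact: noT Hca Hab Hbc.
- exact: noT Hca Hbc Hab.
- exact: noT Hbc Hca Hab.
- exact: noT Hab Hca Hbc.
- exact: noT Hbc Hab Hca.
by case/negP: neq_ab; rewrite -val_eqE /= eqn_leq ab (leq_trans ca bc).
Qed.

Lemma independentP (G : graph) (S : {set G}) :
  reflect {in S &, forall u v, ~~ adj u v} (independent S).
Proof.
apply: (iffP forall_inP) => [H u v uS vS | H u uS]; first exact: (forall_inP (H u uS)).
by apply/forall_inP => v; apply: H.
Qed.

Lemma independent_le_IS (G : graph) (S : {set G}) : independent S -> #|S| <= IS G.
Proof. exact: leq_bigmax_cond. Qed.

(** * Weights satisfying the expansion inequality along edges *)

Section WeightedIS.

Variables (G : graph) (w : G -> nat) (q : nat).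
Let n := #|G|.
Let N := q.+1 ^ 2.
Hypothesis q_ge : n * n + 4 * n <= q.
Hypothesis w_le : forall u, w u <= N.
(** This is [expanding] for the traces over the ends of an edge, where q + 1 is the prime and N the
    size of a copy. *)
Hypothesis w_adj : forall u v, adj u v -> q ^ 2 * w u <= (N - w v) * (q + w u).

(* Such a trace has at least n times as many neighbours as elements. *)
Let small u := n * (q + w u) <= q ^ 2.

(** Smallness and expansion give n (w u) (q + w u) <= q^2 (w u) <= (N - w v) (q + w u), and the
    common factor cancels. *)
Lemma small_charge u v : small u -> adj u v -> n * w u <= N - w v.
Proof.
rewrite /small => su /w_adj; case: (posnP (w u)) => [-> _ | wu_gt0 wuv].
  by rewrite muln0.
rewrite -(@leq_pmul2r (q + w u)) ?addn_gt0 ?wu_gt0 ?orbT //.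
by apply: leq_trans wuv; rewrite mulnAC leq_mul2r su orbT.
Qed.

(** With a, b the weights of u, v, expansion along an edge gives b <= 2q + 1 + q^3 / (q + a). As u
    is not small, the last term is below n q, and this leaves b too little for v not to be small.
    Everything is kept multiplied by q + a to avoid division. *)
Lemma large_nonadjacent u v : ~~ small u -> ~~ small v -> ~~ adj u v.
Proof.
have n_gt0 : 0 < n by apply/card_gt0P; exists u.
rewrite /small -!ltnNge => su sv; apply/negP => /w_adj.
have := w_le v; rewrite /N; move: (w u) (w v) su sv => a b su sv le_b.
move=> H.
have q_gt0 : 0 < q by nia.
have X_gt0 : 0 < q + a by nia.
have bX : b * (q + a) <= (2 * q + 1) * (q + a) + q ^ 2 * q.
  have : (q.+1 ^ 2 - b) * (q + a) + b * (q + a) = q.+1 ^ 2 * (q + a).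
    by rewrite -mulnDl subnK.
  by rewrite -!mulnn in H *; nia.
have h1 : n * (q ^ 2 * q) <= n * n * q * (q + a).
  by have := leq_mul (leqnn (n * q)) (ltnW su); nia.
have h2 : q ^ 2 * (q + a) < n * (q + b) * (q + a) by rewrite ltn_pmul2r.
have h3 : q ^ 2 * (q + a) < (n * q + n * (2 * q + 1) + n * n * q) * (q + a).
  have hb := leq_mul (leqnn n) bX; apply: leq_trans h2 _.
  by move: hb h1; move: (q + a) (q ^ 2 * q) => X Y; lia.
(* Cancelling q + a leaves q^2 < (n^2 + 3n) q + n <= (n^2 + 4n) q <= q^2; this is the source of the
   bound on q. *)
rewrite ltn_pmul2r // in h3.
have := leq_mul q_ge (leqnn q); have := leq_pmulr n q_gt0.
by rewrite [q * q]mulnn; move: (q ^ 2) h3 => Y; lia.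
Qed.

Lemma sum_weight_le : \sum_u w u <= IS G * N.
Proof.
pose S := [set u | ~~ small u].
have indepS : independent S.
  by apply/independentP => u v; rewrite !inE; apply: large_nonadjacent.
have [n0 | n_gt0] := posnP n.
  by rewrite big1 // => u; have := card0_eq n0 u; rewrite inE.
(* T collects the small vertices with a neighbour in S, T0 those without. *)
pose T := [set u in ~: S | [exists v in S, adj u v]].
pose T0 := ~: S :\: T.
have sumE : \sum_u w u = \sum_(u in S) w u + (\sum_(u in T) w u + \sum_(u in T0) w u).
  rewrite (bigID (mem S)) /=; congr (_ + _).
  rewrite (bigID (mem T)) /=; congr (_ + _); apply: eq_bigl => u; rewrite !inE.
    by case: (small u).
  by case: (small u); rewrite //= andbT.
(* Each u in T charges n times its weight to the room over one neighbour in S. As T has at most n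
   elements, the total charge is at most n times the whole room. *)
have sumT : \sum_(u in T) w u <= \sum_(v in S) (N - w v).
  rewrite -(leq_pmul2l n_gt0) big_distrr /=.
  apply: leq_trans (_ : \sum_(u in T) \sum_(v in S) (N - w v) <= _).
    apply: leq_sum => u; rewrite !inE negbK => /andP[su /existsP[v /andP[vS uv]]].
    by rewrite (bigD1 v) //= (leq_trans (small_charge su uv)) ?leq_addr.
  by rewrite sum_nat_const leq_mul2r max_card orbT.
have sumS : \sum_(u in S) w u + \sum_(v in S) (N - w v) = #|S| * N.
  by rewrite -big_split -sum_nat_const /=; apply: eq_bigr => u _; rewrite subnKC.
rewrite sumE addnA; apply: leq_trans (leq_add (leq_add (leqnn _) sumT) (leqnn _)) _.
rewrite sumS; have [-> | [t tT0]] := set_0Vmem T0.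
  by rewrite big_set0 addn0 leq_mul2r independent_le_IS ?orbT.
(* Smallness gives n (w u) <= q^2 <= N, and T0 has at most n elements. The vertex t added to S pays
   for this N. *)
have sumT0 : \sum_(u in T0) w u <= N.
  rewrite -(leq_pmul2l n_gt0) big_distrr /=.
  apply: leq_trans (_ : \sum_(u in T0) N <= _).
    apply: leq_sum => u; rewrite !inE negbK => /andP[_ su].
    by move: su; rewrite /small /N -!mulnn; nia.
  by rewrite sum_nat_const leq_mul2r max_card orbT.
have tS : t \notin S by move: tT0; rewrite !inE => /andP[_].
have tadj v : v \in S -> ~~ adj t v.
  move=> vS; move: tT0; rewrite in_setD [t \in T]inE in_setC tS /= andbT.
  by move/existsPn/(_ v); rewrite vS.
have indep_tS : independent (t |: S).
  apply/independentP => u v /setU1P[-> | uS] /setU1P[-> | vS].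
  - by rewrite adj_irr.
  - exact: tadj.
  - by rewrite adj_sym tadj.
  - exact: (independentP _ indepS).
apply: leq_trans (leq_add (leqnn _) sumT0) _.
rewrite -mulSnr leq_mul2r; apply/orP; right.
by have := independent_le_IS indep_tS; rewrite cardsU1 tS.
Qed.

End WeightedIS.

Lemma card_lift_graph G : #|lift_graph G| = #|G| * side #|G| ^ 2.
Proof. by rewrite !card_prod card_ord mulnn. Qed.

Lemma IS_lift_graph G : IS (lift_graph G) = IS G * side #|G| ^ 2.
Proof.
set p := side #|G|; apply/eqP; rewrite eqn_leq; apply/andP; split.
  apply/bigmax_leqP => S /independentP indS.
  pose A u := [set x | (u, x) \in S].
  have p_pr : prime p := side_prime _.
  have p_gt2 : 2 < p := side_gt2 _.
  have -> : #|S| = \sum_u #|A u|.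
    rewrite -sum1_card (eq_bigl (fun a => (true && ((a.1, a.2) \in S)))); last by case.
    rewrite -(pair_big_dep xpredT (fun u x => (u, x) \in S) (fun _ _ => 1)) /=.
    by apply: eq_bigr => u _; rewrite -sum1dep_card.
  have defp : p = p.-1.+1 by rewrite prednK ?prime_gt0.
  rewrite defp; apply: sum_weight_le => [|u|u v uv].
  - by have := side_ge #|G|; rewrite -/p /side_bound; lia.
  - by rewrite -defp (leq_trans (max_card _)) // card_prod card_ord mulnn.
  have noE x y : x \in A u -> y \in A v -> ~~ lift_rel (u, x) (v, y).
    by rewrite !inE => xA yA; apply: (indS (u, x) (v, y)).
  (* The ranks decide whether the edges run from the trace over u to that over v or back; hence
     expansion is needed for [parabola] and for its converse. *)
  rewrite -defp; case: (ltnP (enum_rank u) (enum_rank v)) => [lt_uv | le_vu].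
    apply: (expanding_parabola p_pr p_gt2) => x y xA yA.
    by have := noE x y xA yA; rewrite /lift_rel /= uv lt_uv.
  apply: (expanding_parabolaC p_pr p_gt2) => x y xA yA.
  by have := noE x y xA yA; rewrite /lift_rel /= uv ltnNge le_vu.
rewrite /IS; case: (@eq_bigmax_cond _ (fun S : {set G} => independent S) (fun S => #|S|)).
  by apply/card_gt0P; exists set0; apply/independentP => u v; rewrite inE.
move=> S indS ->.
(* Conversely, the full copies over a maximum independent set of G form an independent set. *)
have -> : #|S| * p ^ 2 = #|setX S [set: 'I_p * 'I_p]|.
  by rewrite cardsX cardsT card_prod card_ord mulnn.
apply: (@independent_le_IS (lift_graph G)); apply/independentP => -[u x] [v y].
rewrite !in_setX => /andP[aS _] /andP[bS _]; rewrite /= /lift_rel.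
by rewrite (negPf (independentP _ indS _ _ aS bS)).
Qed.

Lemma rel_IS_lift_graph G : rel_IS (lift_graph G) = rel_IS G.
Proof.
rewrite /rel_IS IS_lift_graph card_lift_graph (natrM _ (IS G)) (natrM _ #|G|).
have p_neq0 : ((side #|G| ^ 2)%:R != 0 :> rat)%R.
  by rewrite Num.Theory.pnatr_eq0 expn_eq0 negb_and -lt0n prime_gt0 ?side_prime.
(* [mulf_div] asks for no nonzero denominator, so the graph without vertices is covered too. *)
by rewrite -mulf_div divff // mulr1.
Qed.

(** * Structured code for the random access machine *)

(** Jump targets are absolute, so code is a function of the address at which it is placed. *)
Definition code := nat -> seq instr.

Definition goto (k : nat) (s : config) : config := Config k (reg s) (inp s) (out s).

Definition loads (P : program) (o : nat) (l : seq instr) : Prop :=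
  exists pre suf, P = pre ++ l ++ suf /\ size pre = o.

Lemma loads_cat P o l1 l2 :
  loads P o (l1 ++ l2) -> loads P o l1 /\ loads P (o + size l1) l2.
Proof.
case=> pre [suf [-> <-]]; split; first by exists pre, (l2 ++ suf); rewrite -catA.
by exists (pre ++ l1), suf; rewrite -!catA size_cat.
Qed.

Lemma loads_cons P o a l :
  loads P o (a :: l) -> onth P o = Some a /\ loads P o.+1 l.
Proof.
rewrite -cat1s => /loads_cat[[pre [suf [-> <-]]] ld]; rewrite addn1 in ld; split=> //.
by rewrite onth_cat ltnn subnn.
Qed.

Lemma step_at P o a s : onth P o = Some a -> step P (goto o s) = exec a (goto o s).
Proof. by rewrite /step /= => ->. Qed.

(** A total-correctness triple with time bound t: wherever c is loaded, execution from its first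
    line reaches the line just after it. [Q] is applied to a state whose program counter is
    arbitrary. *)
Definition runs (c : code) (t : nat) (s : config) (Q : config -> Prop) : Prop :=
  forall P o, loads P o (c o) -> exists k s',
    [/\ k <= t, iter k (step P) (goto o s) = goto (o + size (c o)) s' & Q s'].

Lemma runs_le c t t' s (Q Q' : config -> Prop) :
  runs c t s Q -> t <= t' -> (forall s', Q s' -> Q' s') -> runs c t' s Q'.
Proof.
move=> Hc le_t sQ P o /Hc[k [s' [le_k Ek Qs']]]; exists k, s'.
by split=> //; [apply: leq_trans le_t | apply: sQ].
Qed.

Definition straight (a : instr) : bool := if a is IJumpPos _ _ then false else true.

Definition block (l : seq instr) : code := fun=> l.

Definition exec_seq (s : config) (l : seq instr) : config :=
  foldl (fun s a => exec a s) s l.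

Lemma exec_goto a o s : straight a -> exec a (goto o s) = goto o.+1 (exec a s).
Proof. by case: a. Qed.

Lemma runs_block l s (Q : config -> Prop) :
  all straight l -> Q (exec_seq s l) -> runs (block l) (size l) s Q.
Proof.
move=> str Qs P o ld; exists (size l), (exec_seq s l); split=> //.
rewrite /block in ld *; elim: l s o str ld {Qs} => [|a l IHl] s o /=.
  by rewrite addn0.
case/andP=> str_a str_l /loads_cons[at_o ld].
by rewrite -iterS iterSr (step_at _ at_o) exec_goto // IHl // addSnnS.
Qed.

Definition seqc (c1 c2 : code) : code := fun o => c1 o ++ c2 (o + size (c1 o)).
Notation "c1 ;; c2" := (seqc c1 c2) (at level 85, right associativity).

Lemma runs_seq c1 c2 t1 t2 s (Q : config -> Prop) :
  runs c1 t1 s (fun s' => runs c2 t2 s' Q) -> runs (c1 ;; c2) (t1 + t2) s Q.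
Proof.
move=> Hc P o /loads_cat[/Hc[k1 [s1 [le1 E1 H2]]] /H2[k2 [s2 [le2 E2 Qs]]]].
exists (k2 + k1), s2; split=> //; first by rewrite addnC leq_add.
by rewrite iterD E1 E2 size_cat addnA.
Qed.

(* Register 0 is reserved for jump conditions: [test] leaves the condition there. *)
Definition while_loop (test body : code) : code := fun o =>
  let o' := o.+2 + size (body o.+2) in
  [:: IConst 0 1; IJumpPos o' 0] ++ body o.+2 ++ test o' ++ [:: IJumpPos o.+2 0].

(** The index of I counts the remaining rounds. A round costs t1 + t2 + 1 steps, the final failing
    test t1 + 1, and the initial jump to the test, which stands after the body, costs 2. *)
Lemma runs_while (I : nat -> config -> Prop) test body t1 t2 m s (Q : config -> Prop) :
    I m (exec (IConst 0 1) s) ->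
    (forall m s, I m s ->
       runs test t1 s (fun s' => I m s' /\ (0 < reg s' 0) = (0 < m))) ->
    (forall m s, I m.+1 s -> runs body t2 s (I m)) ->
    (forall s', I 0 s' -> Q s') ->
  runs (while_loop test body) (m * (t1 + t2 + 1) + t1 + 3) s Q.
Proof.
move=> I0 Htest Hbody HQ P o; rewrite /while_loop.
set o1 := o.+2; set o2 := o1 + size (body o1).
move=> ld; have [at0 ld1] := loads_cons ld.
have [at1 /loads_cat[ldb ld2]] := loads_cons ld1.
have {ld2} [ldt ldj] := loads_cat ld2; have {ldj} [atj _] := loads_cons ldj.
rewrite -/o1 -/o2 in ldb ldt atj.
have loop : forall m s, I m s -> exists k s',
    [/\ k <= m * (t1 + t2 + 1) + t1 + 1,
     iter k (step P) (goto o2 s) = goto (o2 + size (test o2)).+1 s' & I 0 s'].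
  elim=> [|m' IHm] s1 I1.
    have [k [s2 [le_k Ek [I2 z2]]]] := Htest _ _ I1 P o2 ldt.
    exists k.+1, s2; split=> //; first by rewrite mul0n add0n addn1.
    by rewrite iterS Ek (step_at _ atj) /= z2.
  have [k [s2 [le_k Ek [I2 z2]]]] := Htest _ _ I1 P o2 ldt.
  have [k' [s3 [le_k' Ek' I3]]] := Hbody _ _ I2 P o1 ldb.
  have [k'' [s4 [le_k'' Ek'' I4]]] := IHm _ I3.
  exists (k'' + (k' + k.+1)), s4; split=> //; first by nia.
  rewrite iterD iterD iterS Ek (step_at _ atj) /= z2 /=.
  by rewrite -[Config o1 _ _ _]/(goto o1 s2) Ek' Ek''.
have [k [s' [le_k Ek Is']]] := loop _ _ I0.
exists (k + 2), s'; split; last exact: HQ; first by lia.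
rewrite iterD /= (step_at _ at0) /= (step_at (exec (IConst 0 1) s) at1) /=.
rewrite -[Config o2 _ _ _]/(goto o2 (exec (IConst 0 1) s)) Ek.
by congr (goto _ _); rewrite !size_cat /= /o2 /o1; lia.
Qed.

(* [l] lists the registers that may change, and [y] is what is printed. *)
Definition emits (l : seq nat) (y : seq nat) (s s' : config) : Prop :=
  [/\ forall r, r \notin l -> reg s' r = reg s r, inp s' = inp s & out s' = out s ++ y].

Lemma emits_refl l s : emits l [::] s s.
Proof. by split; rewrite ?cats0. Qed.

Lemma emits_trans l y1 y2 s1 s2 s3 :
  emits l y1 s1 s2 -> emits l y2 s2 s3 -> emits l (y1 ++ y2) s1 s3.
Proof.
move=> [r1 i1 o1] [r2 i2 o2]; split; rewrite ?i2 ?o2 ?o1 ?catA // => r rl.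
by rewrite r2 ?r1.
Qed.

Lemma emits_sub l l' y s s' : all (mem l') l -> emits l y s s' -> emits l' y s s'.
Proof.
move=> /allP sub [r1 i1 o1]; split=> // r rl; apply: r1.
by apply: contra rl; apply: sub.
Qed.

Lemma emits_reg l y s s' r : emits l y s s' -> r \notin l -> reg s' r = reg s r.
Proof. by case=> + _ _; apply. Qed.

Definition for_loop (i r : nat) (body : code) : code :=
  block [:: IConst i 0] ;;
  while_loop (block [:: ISub 0 r i]) (body ;; block [:: IConst 0 1; IAdd i i 0]).

(** The overhead of the loop changes only register 0 and the counter, so the invariant has to be
    insensitive to these. It costs 4 steps per round: the test, its jump and the two instructions of
    the increment. *)
Lemma runs_for (I : nat -> config -> Prop) i r c t N s (Q : config -> Prop) :
    i != 0 -> r != 0 -> r != i ->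
    (forall k s s', emits [:: 0; i] [::] s s' -> I k s -> I k s') ->
    reg s r = N -> I 0 s ->
    (forall k s1, k < N -> reg s1 i = k -> reg s1 r = N -> I k s1 ->
       runs c t s1 (fun s2 => [/\ reg s2 i = k, reg s2 r = N & I k.+1 s2])) ->
    (forall s', I N s' -> Q s') ->
  runs (for_loop i r c) (N * (t + 4) + 5) s Q.
Proof.
move=> i0 r0 ri Iext rN I0 Hc HQ.
have [/negPf i0' /negPf r0' /negPf ri'] := And3 i0 r0 ri.
pose J m s1 := exists k, [/\ k + m = N, reg s1 i = k, reg s1 r = N & I k s1].
apply: (@runs_le _ (1 + (N * (1 + (t + 2) + 1) + 1 + 3)) _ _ Q) => //; last by lia.
apply/runs_seq/(@runs_block [:: _]) => //=.
apply: (@runs_while J); last 1 first.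
- by move=> s' [k [kN _ _ Ik]]; apply: HQ; rewrite -kN addn0.
- exists 0; rewrite /= !eqxx i0' ri' r0' rN add0n; split=> //.
  apply: Iext I0; split; rewrite ?cats0 //= => x.
  by rewrite !inE negb_or => /andP[/negPf-> /negPf->].
- move=> m s1 [k [kN ik rk Ik]]; apply: (@runs_block [:: _]) => //=; split.
    exists k; rewrite /= i0' r0'; split=> //.
    apply: Iext Ik; split; rewrite ?cats0 //= => x.
    by rewrite !inE negb_or => /andP[/negPf-> _].
  by rewrite ik rk -kN addKn.
move=> m s1 [k [kN ik rk Ik]]; apply: runs_seq.
have ltkN : k < N by rewrite -kN -addSnnS leq_addr.
apply: runs_le (Hc k s1 ltkN ik rk Ik) _ _ => // s2 [ik2 rk2 Ik2].
apply: (@runs_block [:: _; _]) => //=; exists k.+1.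
rewrite /= !eqxx i0' ri' r0' ik2 addn1 -kN addSnnS; split=> //.
  by rewrite rk2 kN.
apply: Iext Ik2; split; rewrite ?cats0 //= => x.
by rewrite !inE negb_or => /andP[/negPf-> /negPf->].
Qed.

Definition cat_iota (N : nat) (g : nat -> seq nat) : seq nat :=
  flatten [seq g k | k <- iota 0 N].

(** For nested printing loops no separate invariant is needed: the body may rely on all registers
    outside i :: l being as at the start, whatever has been printed so far. *)
Lemma runs_for_emits i r c t N s l (g : nat -> seq nat) :
    0 \in l -> i \notin l -> r \notin i :: l -> reg s r = N ->
    (forall k s1 y, k < N -> reg s1 i = k -> emits (i :: l) y s s1 ->
       runs c t s1 (emits l (g k) s1)) ->
  runs (for_loop i r c) (N * (t + 4) + 5) s (emits (i :: l) (cat_iota N g) s).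
Proof.
move=> l0 il; rewrite inE negb_or => /andP[ri rl] rN Hc.
pose I k s1 := emits (i :: l) (cat_iota k g) s s1.
have nz x : x \notin l -> x != 0 by apply: contraNneq => ->.
apply: (runs_for (I := I)); rewrite ?nz //.
- move=> k s1 s2 E I1; rewrite /I -[cat_iota _ _]cats0; apply: emits_trans I1 _.
  by apply: emits_sub E; rewrite /= !inE l0 eqxx orbT.
- exact: emits_refl.
move=> k s1 ltkN ik rk Ik; apply: runs_le (Hc k s1 _ ltkN ik Ik) _ _ => // s2 E.
split; first by rewrite (emits_reg E).
  by rewrite (emits_reg E).
rewrite /I /cat_iota -addn1 iotaD map_cat flatten_cat /= cats0; apply: emits_trans Ik _.
by apply: emits_sub E; apply/allP => x xl; rewrite /= inE xl orbT.
Qed.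

Definition mul_code (d a b : nat) : code :=
  block [:: IConst d 0] ;; for_loop 9 a (block [:: IAdd d d b]).

Lemma runs_mul d a b va vb s (Q : config -> Prop) :
    d \notin [:: 0; 9; a; b] -> a \notin [:: 0; 9] -> b \notin [:: 0; 9] ->
    reg s a = va -> reg s b = vb ->
    (forall s', emits [:: 0; 9; d] [::] s s' -> reg s' d = va * vb -> Q s') ->
  runs (mul_code d a b) (va * 5 + 6) s Q.
Proof.
rewrite !inE !negb_or => /and4P[d0 d9 da db] /andP[a0 a9] /andP[b0 b9] Ea Eb HQ.
pose I k s1 := [/\ emits [:: 0; 9; d] [::] s s1 & reg s1 d = k * vb].
have dR x : d != x -> (x == d) = false by rewrite eq_sym => /negPf.
apply: (@runs_le _ (1 + (va * (1 + 4) + 5)) _ _ Q) => //; last by lia.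
apply/runs_seq/(@runs_block [:: _]) => //=.
apply: (runs_for (I := I)) => //=.
- move=> k s1 s2 E [E1 d1]; split.
    by apply: (emits_trans (y2 := [::]) E1); apply: emits_sub E.
  by rewrite (emits_reg E) // !inE negb_or d0 d9.
- by rewrite dR.
- split; last by rewrite /= eqxx.
  split; rewrite ?cats0 //= => x; rewrite !inE !negb_or => /and3P[_ _ /negPf->] //.
- move=> k s1 ltk k9 ka [E1 d1]; apply: (@runs_block [:: _]) => //=.
  rewrite !dR //; split=> //.
  split.
    apply: (emits_trans (y2 := [::]) E1); split; rewrite ?cats0 //= => x.
    by rewrite !inE !negb_or => /and3P[_ _ /negPf->].
  by rewrite /= eqxx d1 (emits_reg E1) ?Eb ?mulSnr // !inE !negb_or b0 b9 eq_sym.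
by move=> s' [E1 d1]; apply: HQ.
Qed.

(** Repeated subtraction: the truncated difference d + 1 - b is positive exactly when b can be
    subtracted once more. *)
Definition mod_code (d a b : nat) : code :=
  block [:: IConst d 0; IAdd d d a] ;;
  while_loop (block [:: IConst 0 1; IAdd 0 d 0; ISub 0 0 b]) (block [:: ISub d d b]).

Lemma runs_mod d a b va vb s (Q : config -> Prop) :
    d \notin [:: 0; a; b] -> a != 0 -> b != 0 ->
    reg s a = va -> reg s b = vb -> 0 < vb ->
    (forall s', emits [:: 0; d] [::] s s' -> reg s' d = va %% vb -> Q s') ->
  runs (mod_code d a b) (va * 5 + 8) s Q.
Proof.
rewrite !inE !negb_or => /and3P[d0 da db] a0 b0 Ea Eb vb_gt0 HQ.
have dR x : d != x -> (x == d) = false by rewrite eq_sym => /negPf.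
pose I m s1 := [/\ emits [:: 0; d] [::] s s1 & reg s1 d = m * vb + va %% vb].
apply: (@runs_le _ (2 + (va %/ vb * (3 + 1 + 1) + 3 + 3)) _ _ Q) => //; last first.
  by have := leq_div va vb; lia.
apply/runs_seq/(@runs_block [:: _; _]) => //=.
have emitsE s1 s2 : emits [:: 0; d] [::] s s1 -> emits [:: 0; d] [::] s1 s2 ->
    emits [:: 0; d] [::] s s2 by apply: (@emits_trans _ [::] [::]).
have bR s1 : emits [:: 0; d] [::] s s1 -> reg s1 b = vb.
  by move=> E; rewrite (emits_reg E) ?Eb // !inE negb_or b0 eq_sym.
apply: (runs_while (I := I)).
- split; last by rewrite /= !eqxx (negPf d0) dR // Ea add0n -divn_eq.
  split; rewrite ?cats0 //= => x; rewrite !inE !negb_or.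
  by case/andP=> /negPf-> /negPf->.
- move=> m s1 [E1 d1]; apply: (@runs_block [:: _; _; _]) => //=.
  split; first split.
  + apply: emitsE (E1) _; split; rewrite ?cats0 //= => x; rewrite !inE !negb_or.
    by case/andP=> /negPf->.
  + by rewrite /= (negPf d0).
  rewrite (negPf b0) (negPf d0) /= d1 (bR _ E1).
  have := ltn_pmod va vb_gt0; set rr := _ %% _; case: m {d1} => [|m] ltr.
    by rewrite mul0n add0n addn1; apply/negbTE; rewrite -leqNgt leqn0 subn_eq0.
  by rewrite mulSn subn_gt0; lia.
- move=> m s1 [E1 d1]; apply: (@runs_block [:: _]) => //=; split.
    apply: emitsE (E1) _; split; rewrite ?cats0 //= => x; rewrite !inE !negb_or.
    by case/andP=> _ /negPf->.
  by rewrite /= eqxx d1 (bR _ E1) mulSn -addnA addKn.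
by move=> s' [E1 d1]; apply: HQ.
Qed.

Lemma iter_step_halted P c t : size P <= pc c -> iter t (step P) c = c.
Proof. by move=> halt; elim: t => //= t ->; rewrite /step onth_default. Qed.

(** [halts_within] inspects the configuration after exactly t steps and [runs] stops after some k <=
    t; a halted configuration does not change any more. *)
Lemma runs_halts (c : code) x y t :
  runs c t (init_config x) (fun s => out s = y) -> halts_within (c 0) x t y.
Proof.
move=> /(_ (c 0) 0); case; first by exists [::], [::]; rewrite cats0.
move=> k [s [le_kt Ek outs]]; rewrite /halts_within -(subnK le_kt) iterD.
have -> : iter k (step (c 0)) (init_config x) = goto (0 + size (c 0)) s by [].
by rewrite iter_step_halted //= add0n leqnn.
Qed.

(** * The program *)

(* Registers: 1 holds the number of vertices n, 2 the prime p, 3 to 8 the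
   coordinates i, x1, x2, j, y1, y2 of the two vertices of the current entry;
   0 and 9 to 18 are scratch, and the adjacency matrix starts at 40. *)
Definition read_code : code :=
  block [:: IRead 1] ;; mul_code 10 1 1 ;;
  for_loop 3 10 (block [:: IRead 11; IConst 12 40; IAdd 12 12 3; IStore 12 11]).

Lemma runs_read x (n : nat) (M : seq nat) (Q : config -> Prop) :
    x = n :: M -> size M = n * n ->
    (forall s', reg s' 1 = n -> reg s' 10 = n * n -> out s' = [::] ->
       (forall k, k < n * n -> reg s' (40 + k) = nth 0 M k) -> Q s') ->
  runs read_code (n * n * 8 + n * 5 + 12) (init_config x) Q.
Proof.
move=> -> szM HQ.
apply: (@runs_le _ (1 + (n * 5 + 6 + (n * n * (4 + 4) + 5))) _ _ Q) => //; last by lia.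
apply/runs_seq/(@runs_block [:: _]) => //=.
apply/runs_seq/runs_mul => //= s0 E0 v10.
have v1 : reg s0 1 = n by rewrite (emits_reg E0).
have inp0 : inp s0 = M by case: E0.
have out0 : out s0 = [::] by case: E0.
pose I k s := [/\ reg s 1 = n /\ reg s 10 = n * n, out s = [::], inp s = drop k M &
  forall j, j < k -> reg s (40 + j) = nth 0 M j].
apply: (runs_for (I := I)) => //.
- move=> k s s' E [[I1 I1'] I2 I3 I4]; split.
  + by rewrite !(emits_reg E).
  + by case: E => _ _ ->; rewrite I2.
  + by case: E => _ ->.
  by move=> j /I4 <-; rewrite (emits_reg E) // !inE; lia.
- by split=> //; rewrite drop0.
- move=> k s ltk vk vN [I1 I2 I3 I4]; apply: (@runs_block [:: _; _; _; _]) => //=.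
  rewrite !vk /=; split=> //; split=> //.
  + by rewrite I3 -drop1 drop_drop.
  + move=> j; rewrite ltnS leq_eqVlt => /predU1P[-> | ltj].
      by rewrite /= eqxx I3 -nth0 nth_drop addn0.
    by rewrite /= eqn_add2l (ltn_eqF ltj) /= I4.
by move=> s [[I1 I1'] I2 I3 I4]; apply: HQ.
Qed.

(** * Trial division on the machine *)

Definition composite_count (m : nat) : nat := \sum_(k < m - 2) (m %% (k + 2) == 0).

Lemma composite_count_eq0 m : 1 < m -> (composite_count m == 0) = prime m.
Proof.
move=> m_gt1; rewrite /composite_count sum_nat_eq0; apply/forallP/idP => [H | m_pr k].
  apply/primeP; split=> // d dv_m; have [d1 | d_neq1] := eqVneq d 1; first by [].
  have d_gt0 := dvdn_gt0 (ltnW m_gt1) dv_m; have le_dm := dvdn_leq (ltnW m_gt1) dv_m.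
  rewrite /=; apply: contraT => d_neqm.
  have lt_d : d - 2 < m - 2 by lia.
  have := H (Ordinal lt_d); rewrite /= subnK; last by lia.
  by rewrite -/(dvdn d m) dv_m.
rewrite eqb0 -/(dvdn _ _); apply/negP => /((primeP m_pr).2 _)/orP[] /eqP.
  by lia.
by have := ltn_ord k; lia.
Qed.

(** Register 2 starts at n^2 + 4n + 7, one below the bound, because the body increments it before
    testing. Register 11 counts the proper divisors found; it starts at 1 to force a first round,
    and the search ends when it is 0. *)
Definition prime_code : code :=
  block [:: IAdd 2 10 1; IAdd 2 2 1; IAdd 2 2 1; IAdd 2 2 1; IConst 11 7;
            IAdd 2 2 11; IConst 11 1] ;;
  while_loop (block [:: IConst 0 0; IAdd 0 0 11])
   (block [:: IConst 12 1; IAdd 2 2 12; IConst 11 0; IConst 13 2; ISub 14 2 13] ;;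
    for_loop 3 14
      (block [:: IConst 13 2; IAdd 15 3 13] ;; mod_code 16 2 15 ;;
       block [:: IConst 13 1; ISub 16 13 16; IAdd 11 11 16])).

Definition prime_regs : seq nat := [:: 0; 2; 3; 11; 12; 13; 14; 15; 16].

Definition prime_test_time (m : nat) : nat := m * (m * 5 + 17) + 10.

Lemma runs_prime n s (Q : config -> Prop) :
    reg s 1 = n -> reg s 10 = n * n ->
    (forall s', emits prime_regs [::] s s' -> reg s' 2 = side n -> Q s') ->
  runs prime_code (side n * (prime_test_time (side n) + 3) + 12) s Q.
Proof.
move=> v1 v10 HQ; set p := side n.
have [p_pr le_p min_p] := next_primeP (side_bound n); rewrite -/(side n) -/p in p_pr le_p min_p.
pose B := side_bound n; pose b := B.-1.
have Bb : B = b.+1 by rewrite /b /B /side_bound; lia.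
apply: (@runs_le _ (7 + ((p - b) * (2 + prime_test_time p + 1) + 2 + 3)) _ _ Q) => //; last first.
  by have := leq_subr b p; nia.
apply/runs_seq/(@runs_block [:: _; _; _; _; _; _; _]) => //=.
set s0 := set_reg _ _ _.
(* The index m is the distance from the current candidate to p, so the divisor count must vanish
   exactly at m = 0. *)
pose I m s1 := [/\ m <= p - b, emits prime_regs [::] s s1, reg s1 2 = p - m
  & (0 < reg s1 11) = (0 < m)].
have emitsE s1 s2 : emits prime_regs [::] s s1 -> emits prime_regs [::] s1 s2 ->
    emits prime_regs [::] s s2 by apply: (@emits_trans _ [::] [::]).
have em s1 k f : (forall r, r \notin prime_regs -> f r = reg s1 r) ->
    emits prime_regs [::] s1 (Config k f (inp s1) (out s1)).
  by split; rewrite ?cats0.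
have notin r x : r \notin prime_regs -> x \in prime_regs -> (r == x) = false.
  by move=> rN xP; apply: contraNF rN => /eqP->.
apply: (runs_while (I := I)).
- split=> //.
  + by apply: em => r rN /=; rewrite !notin.
  + by rewrite /= v1 v10; move: Bb; rewrite /B /side_bound -/B in le_p *; lia.
  by rewrite /=; lia.
- move=> m s1 [I1 I2 I3 I4]; apply: (@runs_block [:: _; _]) => //=; split=> //.
  split=> //; apply: emitsE (I2) _; apply: em => r rN /=; by rewrite !notin.
- move=> m s1 [I1 I2 I3 I4].
  set q := p - m; have leqp : q <= p by apply: leq_subr.
  have q_gt : b < q by rewrite /q; lia.
  have q_ge8 : 8 <= q by move: Bb; rewrite /B /side_bound; lia.
  apply: (@runs_le _ (5 + ((q - 2) * (2 + (q * 5 + 8 + 3) + 4) + 5)) _ _ (I m)) => //; last first.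
    by rewrite /prime_test_time; have := leq_subr 2 q; nia.
  apply/runs_seq/(@runs_block [:: _; _; _; _; _]) => //=.
  set s2 := set_reg _ _ _.
  have E2 : emits prime_regs [::] s s2.
    by apply: emitsE (I2) _; apply: em => r rN /=; rewrite !notin.
  have v2 : reg s2 2 = q by rewrite /= I3 /q; lia.
  pose J k s3 := [/\ emits prime_regs [::] s s3, reg s3 2 = q &
     reg s3 11 = \sum_(i < k) (q %% (i + 2) == 0)].
  apply: (runs_for (I := J)) => //.
  + move=> k s3 s4 E [J1 J2 J3]; split.
    * by apply: emitsE (J1) _; apply: emits_sub E.
    * by rewrite (emits_reg E).
    by rewrite (emits_reg E).
  + by rewrite -v2 /=.
  + by split=> //; rewrite big_ord0.
  + move=> k s3 ltk vk vN [J1 J2 J3].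
    apply/runs_seq/(@runs_block [:: _; _]) => //=.
    set s4 := set_reg _ _ _.
    have E4 : emits prime_regs [::] s s4.
      by apply: emitsE (J1) _; apply: em => r rN /=; rewrite !notin.
    apply/runs_seq/(@runs_mod _ _ _ q (k + 2)) => //=.
    * by rewrite vk.
    * by rewrite addn2.
    move=> s5 E5 v5; have E5' : emits prime_regs [::] s s5.
      by apply: emitsE (E4) _; apply: emits_sub E5.
    apply: (@runs_block [:: _; _; _]) => //=; split.
    * by rewrite (emits_reg E5).
    * by rewrite (emits_reg E5).
    split.
    * by apply: emitsE (E5') _; apply: em => r rN /=; rewrite !notin.
    * by rewrite /= (emits_reg E5).
    rewrite /= v5 (emits_reg E5) //= J3 big_ord_recr /=; congr (_ + _).
    by case: (q %% _).
  move=> s3 [J1 J2 J3]; split=> //; first by lia.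
  rewrite J3 -/(composite_count q) lt0n composite_count_eq0; last by lia.
  (* At m = 0 the candidate is p itself; a smaller prime candidate would contradict the minimality
     of p. *)
  case: m @q {leqp q_gt q_ge8 I1 I3 I4 v2 s2 E2 J J2 J3} (q_gt) => [|m] q q_gt.
    by rewrite /q subn0 p_pr.
  rewrite /=; apply/negP => q_pr; have := min_p q q_pr; rewrite -/B Bb q_gt => /(_ isT).
  by rewrite /q; have := prime_gt0 p_pr; lia.
by move=> s1 [_ E1 v2 _]; apply: HQ; rewrite ?v2 ?subn0.
Qed.

(** The adjacency of the lifted graph in terms of numbers only, with a the entry of G; see
    [cell_lift_rel]. *)
Definition cell (a : bool) (p i x1 x2 j y1 y2 : nat) : bool :=
  a && if i < j then (x1 != y1) && (y2 == (x2 + distn_sq x1 y1) %% p)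
       else (y1 != x1) && (x2 == (y2 + distn_sq y1 x1) %% p).

(** The final block is free of jumps: 1 - b negates a bit, b - c is b and not c, 1 - |u - v| has the
    value of u = v on bits and is 0 for any unequal numbers, and the sum joins two cases that
    exclude each other. *)
Definition cell_code : code :=
  mul_code 10 3 1 ;;
  block [:: IAdd 10 10 6; IConst 11 40; IAdd 10 11 10; ILoad 10 10;
            ISub 11 4 7; ISub 12 7 4; IAdd 11 11 12] ;;
  mul_code 12 11 11 ;; block [:: IAdd 13 5 12] ;; mod_code 14 13 2 ;;
  block [:: IAdd 13 8 12] ;; mod_code 15 13 2 ;;
  block [:: IConst 18 1;
            ISub 16 14 8; ISub 17 8 14; IAdd 16 16 17; ISub 16 18 16;
            ISub 14 15 5; ISub 17 5 15; IAdd 14 14 17; ISub 14 18 14;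
            ISub 17 6 3; ISub 17 18 17; ISub 16 16 17; ISub 17 18 17;
            ISub 14 14 17; IAdd 16 16 14;
            ISub 11 18 11; ISub 16 16 11; ISub 10 18 10; ISub 16 16 10; IPrint 16].

Definition cell_regs : seq nat := [:: 0; 9; 10; 11; 12; 13; 14; 15; 16; 17; 18].

Definition cell_time (n p : nat) : nat := n * 5 + p * 20 + p * p * 10 + 100.

Lemma subn_eqb u v : 1 - (u - v + (v - u)) = (u == v).
Proof. by case: eqVneq => [->|]; lia. Qed.

Lemma runs_cell (a : bool) n p i x1 x2 j y1 y2 s :
    reg s 1 = n -> reg s 2 = p -> reg s 3 = i -> reg s 4 = x1 -> reg s 5 = x2 ->
    reg s 6 = j -> reg s 7 = y1 -> reg s 8 = y2 -> reg s (40 + (i * n + j)) = a ->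
    i < n -> x1 < p -> x2 < p -> y1 < p -> y2 < p ->
  runs cell_code (cell_time n p) s
    (emits cell_regs [:: nat_of_bool (cell a p i x1 x2 j y1 y2)] s).
Proof.
move=> r1 r2 r3 r4 r5 r6 r7 r8 ra lti ltx1 ltx2 lty1 lty2.
pose d := x1 - y1 + (y1 - x1); have ltd : d <= p by rewrite /d; lia.
set Q := emits _ _ _; apply: (@runs_le _ (i * 5 + 6 + (7 + (d * 5 + 6 + (1 + ((x2 + d * d) * 5 + 8 +
   (1 + ((y2 + d * d) * 5 + 8 + 20))))))) _ _ Q) => //; last first.
  by rewrite /cell_time; have := leq_mul ltd ltd; lia.
have emitsE s1 s2 : emits cell_regs [::] s s1 -> emits cell_regs [::] s1 s2 ->
    emits cell_regs [::] s s2 by apply: (@emits_trans _ [::] [::]).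
have em s1 k f : (forall r, r \notin cell_regs -> f r = reg s1 r) ->
    emits cell_regs [::] s1 (Config k f (inp s1) (out s1)).
  by split; rewrite ?cats0.
have notin r x : r \notin cell_regs -> x \in cell_regs -> (r == x) = false.
  by move=> rN xP; apply: contraNF rN => /eqP->.
apply/runs_seq/(@runs_mul _ _ _ i n) => // s1 e1 v10.
have {}e1 : emits cell_regs [::] s s1 by apply: emits_sub e1.
apply/runs_seq/(@runs_block [:: _; _; _; _; _; _; _]) => //.
set s2 := exec_seq _ _.
have e2 : emits cell_regs [::] s s2.
  by apply: emitsE (e1) _; apply: em => r rN /=; rewrite !notin.
have w10 : reg s2 10 = a.
  by rewrite /= v10 (@emits_reg _ _ _ _ 6 e1) // r6 (emits_reg e1).
have w11 : reg s2 11 = d by rewrite /= !(emits_reg e1) // r4 r7.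
clearbody s2.
apply/runs_seq/(@runs_mul _ _ _ d d) => // s3 e v12.
have {}w10 : reg s3 10 = a by rewrite (emits_reg e).
have {}w11 : reg s3 11 = d by rewrite (emits_reg e).
have e3 : emits cell_regs [::] s s3 by apply: emitsE (e2) _; apply: emits_sub e.
clear e e1 e2.
apply/runs_seq/(@runs_block [:: _]) => //.
set s4 := exec_seq _ _.
have e4 : emits cell_regs [::] s s4.
  by apply: emitsE (e3) _; apply: em => r rN /=; rewrite !notin.
apply/runs_seq/(@runs_mod _ _ _ (x2 + d * d) p) => //.
- by rewrite /= (emits_reg e3) // r5 v12.
- by rewrite (emits_reg e4).
- by lia.
move=> s5 e v14.
have {}w10 : reg s5 10 = a by rewrite (emits_reg e).
have {}w11 : reg s5 11 = d by rewrite (emits_reg e).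
have {}v12 : reg s5 12 = d * d by rewrite (emits_reg e).
have e5 : emits cell_regs [::] s s5 by apply: emitsE (e4) _; apply: emits_sub e.
clear e e3 e4.
apply/runs_seq/(@runs_block [:: _]) => //.
set s6 := exec_seq _ _.
have e6 : emits cell_regs [::] s s6.
  by apply: emitsE (e5) _; apply: em => r rN /=; rewrite !notin.
apply/runs_seq/(@runs_mod _ _ _ (y2 + d * d) p) => //.
- by rewrite /= (emits_reg e5) // r8 v12.
- by rewrite (emits_reg e6).
- by lia.
move=> s7 e v15.
have {}w10 : reg s7 10 = a by rewrite (emits_reg e).
have {}w11 : reg s7 11 = d by rewrite (emits_reg e).
have {}v14 : reg s7 14 = (x2 + d * d) %% p by rewrite (emits_reg e).
have e7 : emits cell_regs [::] s s7 by apply: emitsE (e6) _; apply: emits_sub e.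
clear e e5 e6.
apply: (@runs_block [:: _; _; _; _; _; _; _; _; _; _; _; _; _; _; _; _; _; _; _; _]) => //.
rewrite -[[:: _]]cat0s; apply: emits_trans (e7) _; split=> //.
  by move=> r rN /=; rewrite !notin.
rewrite /= -cats1 w10 w11 v14 v15 !(emits_reg e7) // r3 r5 r6 r8.
have dxy : distn_sq x1 y1 = d * d by rewrite /distn_sq -mulnn.
have dyx : distn_sq y1 x1 = d * d by rewrite /distn_sq -mulnn /d addnC.
have d0 : 1 - d = (x1 == y1) by rewrite /d subn_eqb.
clearbody d; rewrite !subn_eqb /cell d0 dxy dyx; congr (_ ++ [:: _]).
rewrite [y2 == _]eq_sym [x2 == _]eq_sym [y1 == _]eq_sym.
(* With all comparisons abstracted to bits, a truth table remains. *)
move: (_ == y2) (_ == x2) => b1 b2.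
have -> : 1 - (j - i) = ~~ (i < j) by case: ltnP; lia.
by move: (i < j) (x1 == y1) b1 b2; case: (a) => [] [] [] [] [].
Qed.

(** The nesting follows the lexicographic enumeration of the product type, with the row (i, x1, x2)
    outside and the column (j, y1, y2) inside. *)
Definition print_code : code :=
  for_loop 3 1 (for_loop 4 2 (for_loop 5 2 (for_loop 6 1 (for_loop 7 2
    (for_loop 8 2 cell_code))))).

Definition loop_time (N t : nat) : nat := N * (t + 4) + 5.

Definition print_time (n p : nat) : nat :=
  loop_time n (loop_time p (loop_time p (loop_time n (loop_time p
    (loop_time p (cell_time n p)))))).

Definition matrix_text (mat : nat -> nat -> bool) (n p : nat) : seq nat :=
  cat_iota n (fun i => cat_iota p (fun x1 => cat_iota p (fun x2 =>
    cat_iota n (fun j => cat_iota p (fun y1 => cat_iota p (fun y2 =>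
      [:: nat_of_bool (cell (mat i j) p i x1 x2 j y1 y2)])))))).

Definition print_regs : seq nat := [:: 3, 4, 5, 6, 7, 8 & cell_regs].

Lemma runs_print (mat : nat -> nat -> bool) n p s :
    reg s 1 = n -> reg s 2 = p ->
    (forall i j, i < n -> j < n -> reg s (40 + (i * n + j)) = mat i j) ->
  runs print_code (print_time n p) s (emits print_regs (matrix_text mat n p) s).
Proof.
move=> r1 r2 rmat.
rewrite /matrix_text /print_time /loop_time.
apply: (runs_for_emits (l := [:: 4, 5, 6, 7, 8 & cell_regs])) => // i s1 y lti v3 e.
have {}e : emits print_regs y s s1 by apply: emits_sub e.
apply: (runs_for_emits (l := [:: 5, 6, 7, 8 & cell_regs])) => //.
  by rewrite (emits_reg e).
move=> x1 s2 y' ltx1 v4 e'.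
have {}v3 : reg s2 3 = i by rewrite (emits_reg e').
have {}e : emits print_regs (y ++ y') s s2.
  by apply: emits_trans (e) _; apply: emits_sub e'.
clear e'.
apply: (runs_for_emits (l := [:: 6, 7, 8 & cell_regs])) => //.
  by rewrite (emits_reg e).
move: (y ++ y') e => {}y e.
move=> x2 s3 y'' ltx2 v5 e'.
have {}v3 : reg s3 3 = i by rewrite (emits_reg e').
have {}v4 : reg s3 4 = x1 by rewrite (emits_reg e').
have {}e : emits print_regs (y ++ y'') s s3.
  by apply: emits_trans (e) _; apply: emits_sub e'.
clear e'.
apply: (runs_for_emits (l := [:: 7, 8 & cell_regs])) => //.
  by rewrite (emits_reg e).
move: (y ++ y'') e => {}y e.
move=> j s4 z ltj v6 e'.
have {}v3 : reg s4 3 = i by rewrite (emits_reg e').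
have {}v4 : reg s4 4 = x1 by rewrite (emits_reg e').
have {}v5 : reg s4 5 = x2 by rewrite (emits_reg e').
have {}e : emits print_regs (y ++ z) s s4.
  by apply: emits_trans (e) _; apply: emits_sub e'.
clear e'.
apply: (runs_for_emits (l := [:: 8 & cell_regs])) => //.
  by rewrite (emits_reg e).
move: (y ++ z) e => {}y e.
move=> y1 s5 z' lty1 v7 e'.
have {}v3 : reg s5 3 = i by rewrite (emits_reg e').
have {}v4 : reg s5 4 = x1 by rewrite (emits_reg e').
have {}v5 : reg s5 5 = x2 by rewrite (emits_reg e').
have {}v6 : reg s5 6 = j by rewrite (emits_reg e').
have {}e : emits print_regs (y ++ z') s s5.
  by apply: emits_trans (e) _; apply: emits_sub e'.
clear e'.
apply: (runs_for_emits (l := cell_regs)) => //.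
  by rewrite (emits_reg e).
move: (y ++ z') e => {}y e.
move=> y2 s6 z'' lty2 v8 e'.
have {}v3 : reg s6 3 = i by rewrite (emits_reg e').
have {}v4 : reg s6 4 = x1 by rewrite (emits_reg e').
have {}v5 : reg s6 5 = x2 by rewrite (emits_reg e').
have {}v6 : reg s6 6 = j by rewrite (emits_reg e').
have {}v7 : reg s6 7 = y1 by rewrite (emits_reg e').
have {}e : emits print_regs (y ++ z'') s s6.
  by apply: emits_trans (e) _; apply: emits_sub e'.
by apply: runs_cell => //; rewrite (emits_reg e) ?rmat.
Qed.

(** * The encoding of the lifted graph *)

Lemma enum_prodE (T1 T2 : finType) :
  enum {: T1 * T2} = [seq (x, y) | x <- enum T1, y <- enum T2].
Proof. by rewrite [LHS]enumT [Finite.enum]unlock. Qed.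

Lemma flatten_map_pairs (T1 T2 S : Type) (s : seq T1) (t : seq T2)
    (h : T1 * T2 -> seq S) :
  flatten [seq h a | a <- [seq (x, y) | x <- s, y <- t]] =
  flatten [seq flatten [seq h (x, y) | y <- t] | x <- s].
Proof. by elim: s => //= x s IHs; rewrite map_cat flatten_cat IHs -map_comp. Qed.

Lemma flatten_map_ord p (g : nat -> seq nat) (h : 'I_p -> seq nat) :
  (forall x, h x = g x) -> flatten [seq h x | x <- enum 'I_p] = cat_iota p g.
Proof.
by move=> hE; rewrite /cat_iota -val_enum_ord -map_comp; congr flatten; apply: eq_map.
Qed.

Lemma map_enum_rank (T : finType) : [seq val (enum_rank x) | x <- enum T] = iota 0 #|T|.
Proof.
apply: (@eq_from_nth _ 0); first by rewrite size_map size_iota -cardE.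
move=> i; rewrite size_map -cardE => lti; rewrite nth_iota // add0n.
have x0 := enum_val (Ordinal lti).
rewrite (nth_map x0) -?cardE //.
have -> : nth x0 (enum T) i = enum_val (Ordinal lti) by rewrite (enum_val_nth x0).
by rewrite enum_valK.
Qed.

Lemma flatten_map_enum_rank (T : finType) (g : nat -> seq nat) (h : T -> seq nat) :
  (forall x, h x = g (enum_rank x)) -> flatten [seq h x | x <- enum T] = cat_iota #|T| g.
Proof.
by move=> hE; rewrite /cat_iota -map_enum_rank -map_comp; congr flatten; apply: eq_map.
Qed.

Lemma nth_allpairs (S T U : Type) (f : S -> T -> U) x0 y0 z0 s t i j :
    i < size s -> j < size t ->
  nth z0 [seq f x y | x <- s, y <- t] (i * size t + j) = f (nth x0 s i) (nth y0 t j).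
Proof.
elim: s i => // x s IHs [|i] lti ltj /=.
  by rewrite nth_cat size_map ltj (nth_map y0).
rewrite nth_cat size_map mulSn -addnA ltnNge leq_addr /= addKn; exact: IHs.
Qed.

(** Read off the encoding, so that it is total in i and j and agrees with the memory of the
    machine. *)
Definition entry (G : graph) (i j : nat) : bool :=
  nth 0 (behead (encode G)) (i * #|G| + j) == 1.

Lemma entry_rank (G : graph) (u v : G) : entry G (enum_rank u) (enum_rank v) = adj u v.
Proof.
rewrite /entry /= {2}cardE (nth_allpairs _ u u) -?cardE //.
by rewrite -!enum_val_nth !enum_rankK; case: (adj u v).
Qed.

Lemma nth_encode_entry (G : graph) i j : i < #|G| -> j < #|G| ->
  nth 0 (behead (encode G)) (i * #|G| + j) = entry G i j.
Proof.
move=> lti ltj; pose u := enum_val (Ordinal lti).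
by rewrite /entry /= cardE (nth_allpairs _ u u) -?cardE //; case: (adj _ _).
Qed.

Lemma cell_lift_rel (G : graph) (a b : lift_graph G) :
  let i := enum_rank a.1 in let j := enum_rank b.1 in
  adj a b = cell (entry G i j) (side #|G|) i a.2.1 a.2.2 j b.2.1 b.2.2.
Proof. by rewrite /= /lift_rel /cell /parabola entry_rank. Qed.

(** Products are enumerated lexicographically and [enum_rank] turns the vertices of G into 0, ..., n
    - 1, so the matrix unfolds into the six nested loops. *)
Lemma encode_lift_graph (G : graph) : let p := side #|G| in
  encode (lift_graph G) = #|G| * (p * p) :: matrix_text (entry G) #|G| p.
Proof.
rewrite /encode /=; congr (_ :: _); first by rewrite card_lift_graph -mulnn.
have catE s (h : lift_graph G -> nat) : [seq h x | x <- s] = flatten [seq [:: h x] | x <- s].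
  by elim: s => //= x s ->.
under eq_map => a do rewrite catE.
rewrite /matrix_text enum_prodE flatten_map_pairs.
apply: flatten_map_enum_rank => u; rewrite enum_prodE flatten_map_pairs.
apply: flatten_map_ord => x1; apply: flatten_map_ord => x2.
rewrite flatten_map_pairs; apply: flatten_map_enum_rank => v; rewrite flatten_map_pairs.
apply: flatten_map_ord => y1; apply: flatten_map_ord => y2.
congr [:: nat_of_bool _]; exact: (cell_lift_rel (u, (x1, x2)) (v, (y1, y2))).
Qed.

Definition lift_code : code :=
  read_code ;; prime_code ;;
  mul_code 10 2 2 ;; mul_code 11 1 10 ;; block [:: IPrint 11] ;; print_code.

Definition lift_time (n p : nat) : nat :=
  n * n * 8 + n * 5 + 12 + (p * (prime_test_time p + 3) + 12 +
    (p * 5 + 6 + (n * 5 + 6 + (1 + print_time n p)))).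

Lemma runs_lift (G : graph) :
  runs lift_code (lift_time #|G| (side #|G|)) (init_config (encode G))
    (fun s => out s = encode (lift_graph G)).
Proof.
set n := #|G|; set p := side n; set M := behead (encode G).
have szM : size M = n * n by rewrite size_allpairs -cardE.
apply/runs_seq/(runs_read (n := n) (M := M)) => // s1 v1 v10 o1 mem1.
apply/runs_seq/(runs_prime (n := n)) => // s2 e2 w2.
have w1 : reg s2 1 = n by rewrite (emits_reg e2).
have o2 : out s2 = [::] by case: e2 => _ _ ->; rewrite o1.
have mem2 i j : i < n -> j < n -> reg s2 (40 + (i * n + j)) = entry G i j.
  move=> lti ltj; rewrite (emits_reg e2) // mem1 ?nth_encode_entry //.
  by rewrite -/M; nia.
apply/runs_seq/(runs_mul (va := p) (vb := p)) => // s3 e3 w10.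
apply/runs_seq/(runs_mul (va := n) (vb := p * p)) => //.
  by rewrite (emits_reg e3).
move=> s4 e4 w11.
apply/runs_seq/(@runs_block [:: _]) => //; set s5 := exec_seq _ _.
have o5 : out s5 = [:: n * (p * p)].
  by rewrite /= w11; case: e4 => _ _ ->; case: e3 => _ _ ->; rewrite o2.
have E r : r \notin [:: 0; 9; 10; 11] -> reg s5 r = reg s2 r.
  rewrite !inE !negb_or => /and4P[r0 r9 r10 r11].
  by rewrite /= (emits_reg e4) ?(emits_reg e3) // !inE !negb_or ?r0 ?r9 ?r10 ?r11.
apply: runs_le (runs_print (mat := entry G) (n := n) (p := p) _ _ _) (leqnn _) _.
- by rewrite E.
- by rewrite E.
- by move=> i j lti ltj; rewrite E ?mem2.
by move=> s' [_ _ ->]; rewrite o5 encode_lift_graph.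
Qed.

(** * Polynomial running time *)

Definition is_poly (g : nat -> nat) : Prop :=
  exists P : {poly nat}, forall n, g n = P.[n]%R.

Lemma is_poly_const c : is_poly (fun=> c).
Proof. by exists (c%:P)%R => n; rewrite hornerC. Qed.

Lemma is_poly_id : is_poly id.
Proof. by exists 'X%R => n; rewrite hornerX. Qed.

Lemma is_polyD f g : is_poly f -> is_poly g -> is_poly (fun n => f n + g n).
Proof. by move=> [P EP] [Q EQ]; exists (P + Q)%R => n; rewrite hornerD EP EQ. Qed.

Lemma is_polyM f g : is_poly f -> is_poly g -> is_poly (fun n => f n * g n).
Proof. by move=> [P EP] [Q EQ]; exists (P * Q)%R => n; rewrite hornerM EP EQ. Qed.

(** The running time involves the prime itself; monotonicity lets the prime be replaced by its upper
    bound, after which the time is a polynomial in n. *)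
Lemma lift_time_leq n p q : p <= q -> lift_time n p <= lift_time n q.
Proof.
move=> le_pq; rewrite /lift_time /print_time /loop_time /cell_time /prime_test_time.
by repeat first [exact: leqnn | exact: le_pq | apply: leq_add | apply: leq_mul].
Qed.

Lemma is_poly_lift_time : is_poly (fun n => lift_time n (2 * (side_bound n * side_bound n))).
Proof.
rewrite /lift_time /print_time /loop_time /cell_time /prime_test_time /side_bound.
by repeat first [exact: is_poly_const | exact: is_poly_id | apply: is_polyD | apply: is_polyM].
Qed.

Lemma polytime_lift_graph : polytime lift_graph.
Proof.
have [P EP] := is_poly_lift_time; exists (lift_code 0), P => G; rewrite -EP.
apply: runs_halts; apply: runs_le (runs_lift G) (lift_time_leq _ _) _ => //.
by rewrite mulnn next_prime_le // /side_bound; lia.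
Qed.

Theorem theorem8 :
  exists f : graph -> graph,
    polytime f /\
    forall (G : graph) (Delta : nat), max_degree G = Delta ->
      triangle_free (f G) /\ rel_IS (f G) = rel_IS G.
Proof.
exists lift_graph; split; first exact: polytime_lift_graph.
by move=> G _ _; split; [apply: lift_triangle_free | apply: rel_IS_lift_graph].
Qed.
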